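(* Let $F(t)=\sum_{n\geqslant 0} f_n t^n$, where $f_n$ is the number of inversion sequences of size $n$ avoiding both patterns $010$ and $102$. Then $F(t)$ is algebraic with minimal polynomial \begin{align*} &(t^5 -3 t^4 + 4 t^3 - 3 t^2 + t)F^3 + (4 t^4 - 8 t^3 + 6 t^2 - 2t)F^2 \\ & + (-t^4 + 8 t^3 - 11t^2 + 6t - 1) F -2 t^3 + 5 t^2 - 4t + 1. \end{align*}
   Context: An inversion sequence of size $n$ is a sequence $\sigma=(\sigma_1,\dots,\sigma_n)$ of integers with $\sigma_i\in\{0,\dots,i-1\}$ for all $i$ (the empty sequence is the unique one of size $0$). A sequence contains $010$ if it has entries at positions $a<b<c$ with $\sigma_a=\sigma_c<\sigma_b$, and contains $102$ if it has entries at positions $a<b<c$ with $\sigma_b<\sigma_a<\sigma_c$; otherwise it avoids them. Minimal polynomial is meant over $\mathbb{Q}(t)$, with $F(t)$ a formal power series. *)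

(* Defs.v *)
From HB Require Import structures.
From mathcomp Require Import all_boot all_order all_algebra.
From mathcomp Require Import boolp.

Set Implicit Arguments.
Unset Strict Implicit.
Unset Printing Implicit Defensive.

Import GRing.Theory.

Local Open Scope ring_scope.

(* A wrapper around nat -> R is needed because function types already carry
   pointwise algebraic structures. *)
Record fps (R : Type) := Fps { fps_coef : nat -> R }.

Section FpsRing.
Variable R : comNzRingType.
Implicit Types f g h : fps R.

Lemma fps_coefK : cancel (@fps_coef R) (@Fps R).
Proof. by case. Qed.

HB.instance Definition _ := Choice.copy (fps R) (can_type fps_coefK).

Lemma fpsP f g : (forall n, fps_coef f n = fps_coef g n) -> f = g.
Proof. by case: f => f; case: g => g /= /funext ->. Qed.

Definition fps_zero : fps R := Fps (fun=> 0).
Definition fps_opp f : fps R := Fps (fun n => - fps_coef f n).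
Definition fps_add f g : fps R := Fps (fun n => fps_coef f n + fps_coef g n).
Definition fps_one : fps R := Fps (fun n => (n == 0)%:R).
Definition fps_mul f g : fps R :=
  Fps (fun n => \sum_(i < n.+1) fps_coef f i * fps_coef g (n - i)).

Fact fps_addA : associative fps_add.
Proof. by move=> f g h; apply: fpsP => n /=; rewrite addrA. Qed.
Fact fps_addC : commutative fps_add.
Proof. by move=> f g; apply: fpsP => n /=; rewrite addrC. Qed.
Fact fps_add0 : left_id fps_zero fps_add.
Proof. by move=> f; apply: fpsP => n /=; rewrite add0r. Qed.
Fact fps_addN : left_inverse fps_zero fps_opp fps_add.
Proof. by move=> f; apply: fpsP => n /=; rewrite addNr. Qed.

HB.instance Definition _ :=
  GRing.isZmodule.Build (fps R) fps_addA fps_addC fps_add0 fps_addN.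

Definition fps_trunc m f : {poly R} := \poly_(i < m) fps_coef f i.

Lemma coef_trunc m f n : (n < m)%N -> (fps_trunc m f)`_n = fps_coef f n.
Proof. by move=> lt_nm; rewrite coef_poly lt_nm. Qed.

Lemma coef_fps_mul m f g n : (n < m)%N ->
  fps_coef (fps_mul f g) n = (fps_trunc m f * fps_trunc m g)`_n.
Proof.
move=> lt_nm; rewrite coefM /=; apply: eq_bigr => i _.
by rewrite !coef_trunc // (leq_ltn_trans _ lt_nm) ?leq_subr // -ltnS.
Qed.

Fact fps_mulC : commutative fps_mul.
Proof.
by move=> f g; apply: fpsP => n; rewrite !(@coef_fps_mul n.+1) // mulrC.
Qed.

Fact fps_mulA : associative fps_mul.
Proof.
move=> f g h; apply: fpsP => n; rewrite !(@coef_fps_mul n.+1) //.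
transitivity (fps_trunc n.+1 f * (fps_trunc n.+1 g * fps_trunc n.+1 h))`_n.
  rewrite !coefM; apply: eq_bigr => i _; congr (_ * _).
  have lt_i : (n - i < n.+1)%N by rewrite ltnS leq_subr.
  by rewrite coef_trunc // (coef_fps_mul _ _ lt_i).
rewrite mulrA !coefM; apply: eq_bigr => i _; congr (_ * _).
by rewrite coef_trunc // (coef_fps_mul _ _ (ltn_ord i)).
Qed.

Fact fps_mul1 : left_id fps_one fps_mul.
Proof.
move=> f; apply: fpsP => n /=.
rewrite big_ord_recl /= mul1r subn0 big1 ?addr0 // => i _.
by rewrite mul0r.
Qed.

Fact fps_mulDl : left_distributive fps_mul fps_add.
Proof.
move=> f g h; apply: fpsP => n /=; rewrite -big_split /=.
by apply: eq_bigr => i _; rewrite mulrDl.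
Qed.

Fact fps_one_neq0 : fps_one != 0 :> fps R.
Proof.
by apply/eqP => /(congr1 (fun f => fps_coef f 0)) /eqP; rewrite oner_eq0.
Qed.

HB.instance Definition _ := GRing.Zmodule_isComNzRing.Build (fps R)
  fps_mulA fps_mulC fps_mul1 fps_mulDl fps_one_neq0.

Definition fps_unit : pred (fps R) := fun f => `[< exists g, g * f = 1 >].
Definition fps_inv f : fps R :=
  if pselect (exists g, g * f = 1) is left ex then projT1 (cid ex) else f.

Fact fps_mulVx : {in fps_unit, left_inverse 1 fps_inv *%R}.
Proof.
move=> f /asboolP f_unit; rewrite /fps_inv.
by case: pselect => // ex; case: (cid ex).
Qed.
Fact fps_unitPl f g : g * f = 1 -> fps_unit f.
Proof. by move=> gf1; apply/asboolP; exists g. Qed.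
Fact fps_inv_out : {in [predC fps_unit], fps_inv =1 id}.
Proof.
move=> f; rewrite inE => /asboolPn f_nunit; rewrite /fps_inv.
by case: pselect.
Qed.

HB.instance Definition _ := GRing.ComNzRing_hasMulInverse.Build (fps R)
  fps_mulVx fps_unitPl fps_inv_out.

Definition fps_of_poly (p : {poly R}) : fps R := Fps (fun n => p`_n).

Fact fps_of_poly_is_zmod_morphism : zmod_morphism fps_of_poly.
Proof. by move=> p q; apply: fpsP => n /=; rewrite coefB. Qed.
HB.instance Definition _ := GRing.isZmodMorphism.Build {poly R} (fps R)
  fps_of_poly fps_of_poly_is_zmod_morphism.

Fact fps_of_poly_is_monoid_morphism : monoid_morphism fps_of_poly.
Proof.
by split=> [|p q]; apply: fpsP => n; rewrite /= ?coef1 // coefM.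
Qed.
HB.instance Definition _ := GRing.isMonoidMorphism.Build {poly R} (fps R)
  fps_of_poly fps_of_poly_is_monoid_morphism.

Lemma fps_of_poly_inj : injective fps_of_poly.
Proof. move=> p q eq_pq; apply/polyP => n.
exact: (congr1 (fun f => fps_coef f n) eq_pq). Qed.

End FpsRing.

Section FpsDomain.
Variable R : idomainType.
Implicit Types f g : fps R.

Lemma fps_lowest f : f != 0 ->
  exists2 m, fps_coef f m != 0 & forall i, (i < m)%N -> fps_coef f i = 0.
Proof.
move=> f_neq0; have ex : exists n, fps_coef f n != 0.
  apply: contrapT => /forallNP f0; case/eqP: f_neq0.
  by apply: fpsP => n; apply/eqP/negPn/negP/f0.
case: (ex_minnP ex) => m fm min_m; exists m => // i lt_im.
by apply/eqP; apply: contraTT lt_im; rewrite -leqNgt; apply: min_m.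
Qed.

Fact fps_mulf_eq0 : GRing.integral_domain_axiom (fps R).
Proof.
move=> f g fg0; apply: contrapT => /negP; rewrite negb_or => /andP[].
move=> /fps_lowest[m fm f0] /fps_lowest[n gn g0].
have /eqP : fps_coef (f * g) (m + n) = 0 by rewrite fg0.
have lt_m : (m < (m + n).+1)%N by rewrite ltnS leq_addr.
rewrite /= (bigD1 (Ordinal lt_m)) //= addKn big1 ?addr0 => [|i /eqP ne_im].
  by rewrite mulf_eq0 (negPf fm) (negPf gn).
have [/f0 ->|le_mi] := ltnP i m; first by rewrite mul0r.
have lt_mi : (m < i)%N.
  by rewrite ltn_neqAle le_mi andbT; apply/eqP => E; apply/ne_im/val_inj.
rewrite [X in _ * X]g0 ?mulr0 // ltn_subLR ?ltn_add2r //.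
by rewrite -ltnS ltn_ord.
Qed.

HB.instance Definition _ :=
  GRing.ComUnitRing_isIntegral.Build (fps R) fps_mulf_eq0.

End FpsDomain.

Section FracMap.
Variables (A B : idomainType) (phi : {rmorphism A -> B}).
Hypothesis phi_inj : injective phi.
Implicit Types x y : {fraction A}.
Local Notation "x %:F" := (FracField.tofrac x).

(* The extension of an injective ring morphism to the fraction fields,
   u / v |-> phi u / phi v. *)
Definition frac_map of injective phi := fun x : {fraction A} =>
  (phi \n_(repr x))%:F / (phi \d_(repr x))%:F.
Local Notation psi := (frac_map phi_inj).

Lemma frac_numden x : x = (\n_(repr x))%:F / (\d_(repr x))%:F.
Proof.
have d_neq0 : (\d_(repr x))%:F != 0 by rewrite tofrac_eq0 denom_ratioP.
apply: (canRL (mulfK d_neq0)).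
rewrite -{1}[x]reprK; unlock FracField.tofrac.
rewrite -[LHS]FracField.pi_mul; apply/eqmodP.
rewrite /= FracField.equivfE /FracField.mulf.
by rewrite !numden_Ratio ?mulr1 ?oner_eq0 ?denom_ratioP // mulrC.
Qed.

Lemma frac_mapE (u v : A) : v != 0 ->
  psi (u%:F / v%:F) = (phi u)%:F / (phi v)%:F.
Proof.
have phi_neq0 w : w != 0 -> (phi w)%:F != 0.
  by move=> w_neq0; rewrite tofrac_eq0 -(rmorph0 phi) (inj_eq phi_inj).
move=> v_neq0; set x := _ / _; rewrite /frac_map.
have d_neq0 : \d_(repr x) != 0 by rewrite denom_ratioP.
apply/eqP; rewrite eqr_div ?phi_neq0 // -!rmorphM /=.
have /eqP := frac_numden x; rewrite {1}/x eqr_div ?tofrac_eq0 //.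
by rewrite -!tofracM tofrac_eq => /eqP ->.
Qed.

Fact frac_map_is_zmod_morphism : zmod_morphism psi.
Proof.
move=> x y; rewrite [x]frac_numden [y]frac_numden.
set a := \n_(repr x); set b := \d_(repr x).
set c := \n_(repr y); set d := \d_(repr y).
have [b_neq0 d_neq0] : b != 0 /\ d != 0 by rewrite !denom_ratioP.
have phi_neq0 w : w != 0 -> (phi w)%:F != 0.
  by move=> w_neq0; rewrite tofrac_eq0 -(rmorph0 phi) (inj_eq phi_inj).
rewrite !(@frac_mapE _ b, @frac_mapE _ d) // -!mulNr.
rewrite !addf_div ?phi_neq0 ?tofrac_eq0 // -!tofracN -!tofracM -!tofracD.
by rewrite frac_mapE ?mulf_neq0 // rmorphD !rmorphM rmorphN.
Qed.

Fact frac_map_is_monoid_morphism : monoid_morphism psi.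
Proof.
split=> [|x y].
  by rewrite -[1 in LHS]divr1 -tofrac1 frac_mapE ?oner_eq0 // rmorph1 divff
    // tofrac_eq0 oner_eq0.
rewrite [x]frac_numden [y]frac_numden.
rewrite mulf_div -!tofracM !frac_mapE ?mulf_neq0 ?denom_ratioP // mulf_div.
by rewrite !rmorphM.
Qed.

HB.instance Definition _ := GRing.isZmodMorphism.Build
  {fraction A} {fraction B} psi frac_map_is_zmod_morphism.
HB.instance Definition _ := GRing.isMonoidMorphism.Build
  {fraction A} {fraction B} psi frac_map_is_monoid_morphism.

End FracMap.

(* The inclusion of Q(t) = Frac Q[t] into Q((t)) = Frac Q[[t]]. *)
Definition ratfun_laurent : {fraction {poly rat}} -> {fraction (fps rat)} :=
  frac_map (@fps_of_poly_inj rat).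
HB.instance Definition _ := GRing.RMorphism.on ratfun_laurent.

(* Minimal polynomials are not required to be monic: they are determined only
   up to multiplication by a nonzero element of K. *)
Definition minimal_polynomial (K L : fieldType) (iota : {rmorphism K -> L})
    (u : L) (p : {poly K}) : Prop :=
  [/\ p != 0, root (map_poly iota p) u &
      forall q : {poly K}, q != 0 -> root (map_poly iota q) u ->
        (size p <= size q)%N].

Section InversionSequences.
Variable n : nat.
Implicit Type s : {ffun 'I_n -> 'I_n}.

(* Positions are numbered from 0, so the bound on the entry at i is i. *)
Definition inversion_seq s := [forall i, s i <= i]%N.

Definition contains010 s :=
  [exists a : 'I_n, exists b : 'I_n, exists c : 'I_n,
    [&& a < b, b < c, s a == s c & s a < s b]]%N.

Definition contains102 s :=
  [exists a : 'I_n, exists b : 'I_n, exists c : 'I_n,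
    [&& a < b, b < c, s b < s a & s a < s c]]%N.

End InversionSequences.

Definition count_avoiding n :=
  #|[set s : {ffun 'I_n -> 'I_n} |
      [&& inversion_seq s, ~~ contains010 s & ~~ contains102 s]]|.

Definition gf_avoiding : fps rat := Fps (fun n => (count_avoiding n)%:R).

(* Main.v *)
Require Import Defs.
From mathcomp Require Import all_boot all_order all_algebra.
From mathcomp Require Import qpoly ring zify.

Set Implicit Arguments.
Unset Strict Implicit.
Unset Printing Implicit Defensive.

Import GRing.Theory.

Local Open Scope ring_scope.

(* The values that may still follow a prefix form gaps delimited by earlier
   entries, and the continuation visits the gaps in decreasing order; hence the
   generating function of the continuations is a product over the gaps of the
   series W_k of words over k letters, times a factor for the top gap. Before the
   first descent the only other constraint is that the weakly increasing prefix
   stays below the diagonal, so that with U(u) = sum_k W_k u^k one gets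
   F = 1 + t (1/(1 - t) + H_0), where
   H(u) (u - t - t u U(u)) = t (U(u) - 1)/(1 - u) - t H_0.
   The power series X = t + t X U(X) cancels the kernel, and eliminating X
   against the quadratic equation of U gives the cubic for F. It is irreducible
   since at t = -1 it has no root modulo 5. *)

(** * Formal power series *)

Section FpsCoef.
Variable R : comNzRingType.
Implicit Types f g h : fps R.

Lemma fps_coefD f g n : fps_coef (f + g) n = fps_coef f n + fps_coef g n.
Proof. by []. Qed.

Lemma fps_coef_sum (I : Type) (r : seq I) (P : pred I) (F : I -> fps R) n :
  fps_coef (\sum_(i <- r | P i) F i) n = \sum_(i <- r | P i) fps_coef (F i) n.
Proof. exact: (big_morph (fun f => fps_coef f n) (fun f g => fps_coefD f g n)). Qed.

Definition fps_var : fps R := fps_of_poly 'X.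
Definition fps_geom : fps R := Fps (fun=> 1).

Lemma fps_coef_varM f n :
  fps_coef (fps_var * f) n = if n is m.+1 then fps_coef f m else 0.
Proof.
case: n => [|n]; first by rewrite /= big_ord1 coefX mul0r.
rewrite /= big_ord_recl coefX mul0r add0r big_ord_recl coefX mul1r subn1.
by rewrite big1 ?addr0 // => i _; rewrite coefX mul0r.
Qed.

Lemma fps_coef_constM c f n :
  fps_coef (fps_of_poly c%:P * f) n = c * fps_coef f n.
Proof.
rewrite /= big_ord_recl coefC subn0 big1 ?addr0 // => i _.
by rewrite coefC mul0r.
Qed.

Lemma fps_geomP : (1 - fps_var) * fps_geom = 1.
Proof.
apply: fpsP => n; rewrite mulrBl mul1r.
rewrite [LHS](_ : _ = 1 - fps_coef (fps_var * fps_geom) n) // fps_coef_varM.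
by case: n => [|n] /=; rewrite ?subr0 ?subrr.
Qed.

Lemma fps_coef_geomM f n : fps_coef (fps_geom * f) n = \sum_(i < n.+1) fps_coef f i.
Proof. by rewrite mulrC /=; apply: eq_bigr => i _; rewrite mulr1. Qed.

Lemma fps_head_tail f :
  f = fps_of_poly (fps_coef f 0)%:P + fps_var * Fps (fun n => fps_coef f n.+1).
Proof.
apply: fpsP => n; rewrite fps_coefD fps_coef_varM /= coefC.
by case: n => [|n] /=; rewrite ?addr0 ?add0r.
Qed.

Definition fps_eqmod n f g := forall m, (m < n)%N -> fps_coef f m = fps_coef g m.

Lemma fps_eqmodD n f f' g g' : fps_eqmod n f f' -> fps_eqmod n g g' ->
  fps_eqmod n (f + g) (f' + g').
Proof. by move=> ff gg m lt_mn; rewrite !fps_coefD ff ?gg. Qed.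

Lemma fps_eqmodM n f f' g g' : fps_eqmod n f f' -> fps_eqmod n g g' ->
  fps_eqmod n (f * g) (f' * g').
Proof.
move=> ff gg m lt_mn; apply: eq_bigr => i _.
by rewrite ff ?gg // ?(leq_ltn_trans (leq_subr _ _)) // (leq_trans (ltn_ord i)).
Qed.

Lemma fps_eqmod_varM n f g : fps_eqmod n f g ->
  fps_eqmod n.+1 (fps_var * f) (fps_var * g).
Proof. by move=> fg [|m] lt_mn; rewrite !fps_coef_varM // fg. Qed.

Lemma fps_eqmod_sum n (I : Type) (r : seq I) (P : pred I) (F G : I -> fps R) :
  (forall i, fps_eqmod n (F i) (G i)) ->
  fps_eqmod n (\sum_(i <- r | P i) F i) (\sum_(i <- r | P i) G i).
Proof.
by move=> FG m lt_mn; rewrite !fps_coef_sum; apply: eq_bigr => i _; rewrite FG.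
Qed.

Section Contraction.
Variables (I : Type) (T : (I -> fps R) -> I -> fps R).

(** For a contraction, coefficient [n] is the same in all iterates from [n.+1] on, so it is read
    there. *)
Definition fps_fix i := Fps (fun n => fps_coef (iter n.+1 T (fun=> 0) i) n).

Hypothesis T_contr : forall n (f g : I -> fps R),
  (forall i, fps_eqmod n (f i) (g i)) -> forall i, fps_eqmod n.+1 (T f i) (T g i).

Lemma fps_fixE i : fps_fix i = T fps_fix i.
Proof.
have step n j k i' : (n <= j)%N -> (n <= k)%N ->
    fps_eqmod n (iter j T (fun=> 0) i') (iter k T (fun=> 0) i').
  elim: n j k i' => [|n IHn] [|j] [|k] i' //= le_nj le_nk.
  by apply: T_contr => i''; apply: IHn.
apply: fpsP => n.
have -> : fps_coef (fps_fix i) n = fps_coef (iter n.+1 T (fun=> 0) i) n by [].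
apply: (T_contr (n := n)) => // i' m lt_mn.
exact: (step m.+1).
Qed.
End Contraction.

End FpsCoef.

(** * Substitution into a bivariate series *)

Section FpsEval.
Variables (R : comNzRingType).
Implicit Types (x : fps R) (G : fps (fps R)).

(** If [x] has constant term 0, then [x ^+ k] contributes nothing below degree [k], so cutting the
    sum after [k = n] keeps coefficient [n] exact. *)
Definition fps_eval x G : fps R :=
  Fps (fun n => fps_coef (\sum_(k < n.+1) fps_coef G k * x ^+ k) n).

Lemma fps_coef_eval x G n : fps_coef (fps_eval x G) n =
  fps_coef (\sum_(k < n.+1) fps_coef G k * x ^+ k) n.
Proof. by []. Qed.

Lemma fps_eqmod_eval n x y G :
  fps_eqmod n x y -> fps_eqmod n (fps_eval x G) (fps_eval y G).
Proof.
move=> xy m lt_mn; rewrite /fps_eval [LHS]/= [RHS]/=.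
apply: (fps_eqmod_sum (n := n)) => // k; apply: fps_eqmodM => //.
elim: (k : nat) => [|j IHj]; first by rewrite !expr0.
by rewrite !exprS; apply: fps_eqmodM.
Qed.

Variable x : fps R.
Hypothesis x0 : fps_coef x 0 = 0.

Lemma fps_eqmod_exp k : fps_eqmod k (x ^+ k) 0.
Proof.
have -> : x = fps_var R * Fps (fun n => fps_coef x n.+1).
  by rewrite {1}[x]fps_head_tail x0 polyC0 rmorph0 add0r.
elim: k => [|k IHk] //; rewrite exprS -mulrA -[0](mulr0 (fps_var R)).
apply: fps_eqmod_varM; rewrite -[0](mulr0 (Fps (fun n => fps_coef x n.+1))).
exact: fps_eqmodM.
Qed.

Lemma fps_eval_trunc m G : fps_eqmod m (fps_eval x G) (fps_trunc m G).[x].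
Proof.
move=> n lt_nm; rewrite /fps_eval horner_poly [LHS]/=.
rewrite -(subnKC lt_nm) big_split_ord fps_coefD [X in _ = _ + X](_ : _ = 0) ?addr0 //.
rewrite fps_coef_sum big1 // => i _.
have lt_n : (n < n.+1 + i)%N by rewrite leq_addr.
rewrite -[RHS]/(fps_coef (0 : fps R) n) -(mulr0 (fps_coef G (n.+1 + i))).
by apply: (fps_eqmodM (n := n.+1 + i)) => //; apply: fps_eqmod_exp.
Qed.

Lemma fps_evalD G G' : fps_eval x (G + G') = fps_eval x G + fps_eval x G'.
Proof.
apply: fpsP => n; rewrite fps_coefD !fps_coef_eval -fps_coefD -big_split.
by congr (fps_coef _ n); apply: eq_bigr => i _; rewrite fps_coefD mulrDl.
Qed.

Lemma fps_evalM G G' : fps_eval x (G * G') = fps_eval x G * fps_eval x G'.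
Proof.
apply: fpsP => n; set m := n.+1.
rewrite (@fps_eval_trunc m) ?ltnSn //.
rewrite (fps_eqmodM (@fps_eval_trunc m G) (@fps_eval_trunc m G')) ?ltnSn //.
rewrite -hornerM; set q : {poly fps R} := fps_trunc m G * _.
(* The rest of [q] is a multiple of ['X^m], whose value at [x] has no term below degree [m]. *)
have -> : fps_trunc m (G * G') = take_poly m q.
  apply/polyP => i; rewrite coef_poly coef_take_poly.
  by case: ifP => // lt_im; rewrite -coef_fps_mul.
rewrite -[in RHS](poly_take_drop m q) hornerD fps_coefD hornerM hornerXn.
rewrite [X in _ = _ + X](_ : _ = 0) ?addr0 //.
rewrite -[RHS]/(fps_coef (0 : fps R) n) -(mulr0 (drop_poly m q).[x]).
by apply: (fps_eqmodM (n := m)) => //; apply: fps_eqmod_exp.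
Qed.

Lemma fps_eval_poly p : fps_eval x (fps_of_poly p) = p.[x].
Proof.
apply: fpsP => n; set m := maxn n.+1 (size p).
rewrite (@fps_eval_trunc m) ?leq_maxl //.
congr (fps_coef _.[x] n); apply/polyP => i; rewrite coef_poly /=.
case: ltnP => // le_mi; rewrite nth_default // (leq_trans _ le_mi) //.
exact: leq_maxr.
Qed.

End FpsEval.

(** * The gap series *)

Section Words.
Variable R : comNzRingType.
Local Notation t := (fps_var R).
Local Notation c := (fps_geom R).

(* [W k] counts the words over an alphabet of [k] letters avoiding 010 and 102. *)
Definition word_op (W : nat -> fps R) (k : nat) : fps R :=
  if k is k'.+1 then
    1 + t * (\sum_(p < k) W p.+1 + c * \sum_(p < k) W p * (W (k' - p)%N - 1))
  else 1.

Definition word_gf : nat -> fps R := fps_fix word_op.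
Local Notation W := word_gf.

(** [word_op] at [k] calls its argument at [k] itself, so recursion on [k] is impossible; the factor
    [t] gives a contraction instead. *)
Lemma word_gfE k : W k = word_op W k.
Proof.
apply: fps_fixE => n f g fg [|k'] //=; apply: fps_eqmodD => //.
apply: fps_eqmod_varM; apply: fps_eqmodD; first exact: fps_eqmod_sum.
apply: fps_eqmodM => //; apply: fps_eqmod_sum => i.
by apply: fps_eqmodM => //; apply: fps_eqmodD.
Qed.

(* [low_gf g m] counts the continuations, by values in the top gap and above, of a
   word that has already had a descent, when [g] values below the current one
   (in its top gap) and [m] values above it are still usable. *)
Definition low_gf g m : fps R := W g.+1 + c * (W g * (W m - 1)).
Local Notation Psi := low_gf.

(** The first letter has [p] letters below it and [g.-1 - p] above. What follows either never
    exceeds it, a word over [p.+1] letters, or repeats it, then runs through a nonempty word over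
    the larger letters, and ends with a word over the [p] smaller ones. *)
Lemma word_gf_step g : W g = 1 + t * \sum_(p < g) Psi p (g.-1 - p).
Proof.
rewrite word_gfE; case: g => [|g] /=; first by rewrite big_ord0 mulr0 addr0.
by rewrite big_split /= -mulr_sumr.
Qed.

Lemma geomE : t * c = c - 1.
Proof. by rewrite -(fps_geomP R) mulrBl mul1r opprB addrC subrK. Qed.

(** In the expansion of [W g.+1] the largest first letter contributes [Psi g 0 = W g.+1]; the other
    first letters form this sum. *)
Lemma low_gf_drop g : t * \sum_(p < g) Psi p (g - p) = (1 - t) * W g.+1 - 1.
Proof.
have := word_gf_step g.+1; rewrite big_ord_recr /= subnn.
have -> : Psi g 0 = W g.+1.
  by rewrite /Psi [W 0]word_gfE /= subrr !mulr0 addr0.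
by rewrite mulrDr mulrBl mul1r => {1}->; ring.
Qed.

(** The next letter repeats the current one, climbs over [d] values, or drops to [p]. A climb closes
    off the [g] values as a separate gap, hence [W g]; after a drop the current value stays usable,
    hence [g - p]. *)
Lemma low_gf_step g m : Psi g m =
  1 + t * (Psi g m + \sum_(d < m) W g * Psi d (m.-1 - d)
           + \sum_(p < g) Psi p (g - p)).
Proof.
rewrite !mulrDr low_gf_drop -mulr_sumr [t * (W g * _)]mulrCA.
have -> : t * \sum_(i < m) Psi i (m.-1 - i) = W m - 1.
  by rewrite [X in _ = X - 1]word_gf_step [1 + _]addrC addrK.
rewrite /Psi; have := geomE; set a := W g.+1; set b := W g; set e := W m.
move=> tc; apply/eqP; rewrite -subr_eq0; apply/eqP.
transitivity (((c - 1) - t * c) * (b * (e - 1))); first by ring.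
by rewrite tc subrr mul0r.
Qed.

(* [high_gf g e] below is the analogue of [low_gf g m] before the first descent: the usable
   values above the current one are then bounded only by the position, and
   [e] is the excess of the current position over the current value. The term
   [W g * H e] counts the continuations that later exceed the current value. *)
Definition climb_op (H : nat -> fps R) (e : nat) : fps R :=
  t * (H e.+1 + \sum_(d < e.+1) (W d.+1 + W d * H (e - d)%N)).

Definition climb_gf : nat -> fps R := fps_fix climb_op.
Local Notation H := climb_gf.

Lemma climb_gfE e : H e = climb_op H e.
Proof.
apply: fps_fixE => n f g fg e'; apply: fps_eqmod_varM; apply: fps_eqmodD => //.
by apply: fps_eqmod_sum => i; apply: fps_eqmodD => //; apply: fps_eqmodM.
Qed.

Definition high_gf g e : fps R := W g.+1 + W g * H e.
Local Notation Theta := high_gf.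

(** A repetition raises the excess by 1, a climb over [d] values lowers it by [d], and a drop passes
    to [low_gf]. *)
Lemma high_gf_step g e : Theta g e =
  1 + t * (Theta g e.+1 + \sum_(d < e.+1) W g * Theta d (e - d)
           + \sum_(p < g) Psi p (g - p)).
Proof.
rewrite !mulrDr low_gf_drop -mulr_sumr /Theta climb_gfE /climb_op.
by set S := \sum_(d < _) _; ring.
Qed.

End Words.

(** * Separators, gaps and the recursion of the states *)

Definition below (hs : seq nat) v := [seq h <- hs | (h < v)%N].
#[global] Arguments below : simpl never.

Section Separators.
Variable R : comNzRingType.
Local Notation t := (fps_var R).
Local Notation W := (word_gf R).

(* A state is the current value [c], the decreasing list [hs] of the values below
   [c] that separate the gaps of still usable values, and a bound [B] on all
   future values. Dropping to [v] in a lower gap brings the bound down to just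
   below the separator above [v]; in the top gap that separator is [c], which
   itself remains usable. *)
Definition gap c hs := if hs is h :: _ then (c - h.+1)%N else c.

Fixpoint gaps_gf q : fps R :=
  if q is c :: hs then W (gap c hs) * gaps_gf hs else 1.

Fixpoint drop_bound (hs : seq nat) v b :=
  if hs is h :: hs' then if (h < v)%N then b else drop_bound hs' v h.-1 else b.

Definition low_state c hs B := low_gf R (gap c hs) (B - c) * gaps_gf hs.

Definition high_state c hs e := high_gf R (gap c hs) e * gaps_gf hs.

Definition drop_sum c (hs : seq nat) b :=
  \sum_(0 <= v < c | v \notin hs) low_state v (below hs v) (drop_bound hs v b).

Lemma path_gtn_lt c hs h : path gtn c hs -> h \in hs -> (h < c)%N.
Proof.
rewrite path_sortedE; last by move=> x y z /= xy yz; apply: ltn_trans yz xy.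
by case/andP => /allP hc _ /hc.
Qed.

Lemma path_gtn_notin c hs v : path gtn c hs -> (c <= v)%N -> v \notin hs.
Proof. by move=> ch cv; apply/negP => /(path_gtn_lt ch); rewrite ltnNge cv. Qed.

Lemma below_all c hs v : path gtn c hs -> (c <= v)%N -> below hs v = hs.
Proof.
move=> ch cv; apply/all_filterP/allP => h /(path_gtn_lt ch) hc.
exact: leq_trans hc cv.
Qed.

Lemma below_le c hs v : (v <= c)%N -> below (c :: hs) v = below hs v.
Proof. by move=> vc; rewrite /below /= ltnNge vc. Qed.

Lemma drop_sum_nil c b :
  drop_sum c [::] b = \sum_(p < c) low_gf R p (b - p).
Proof.
by rewrite /drop_sum big_mkord; apply: eq_bigr => i _; rewrite /low_state mulr1.
Qed.

Lemma drop_sum_cons c h hs b : path gtn c (h :: hs) ->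
  drop_sum c (h :: hs) b =
    (\sum_(p < gap c (h :: hs)) low_gf R p (b - h.+1 - p)) * gaps_gf (h :: hs)
    + drop_sum h hs h.-1.
Proof.
move=> /= /andP[hc chs]; rewrite /drop_sum (big_cat_nat (n := h.+1)) //=.
rewrite addrC; congr (_ + _).
  rewrite -{1}[h.+1]add0n big_addn big_mkord mulr_suml.
  apply: eq_big => [i|i _].
    by rewrite (@path_gtn_notin h.+1 (h :: hs)) /= ?ltnSn ?leq_addl //; lia.
  rewrite /low_state (@below_all h.+1 (h :: hs)) ?leq_addl //=; last first.
    by rewrite ltnSn.
  by congr (low_gf R _ _ * _); lia.
rewrite big_mkcond big_nat_recr //= mem_head /= addr0 -big_mkcond /=.
rewrite big_nat_cond [RHS]big_nat_cond; apply: eq_big => [v|v].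
  by rewrite in_cons; case: (ltngtP v h).
by case/andP => /= vh _; rewrite below_le ?ltnNge ltnW.
Qed.

(** Gaps are visited in decreasing order: the next letter lies in the top gap, which accounts for
    [W (gap c hs) - 1] times the lower gaps, or the top gap is skipped and the induction applies. *)
Lemma drop_sumE c hs : path gtn c hs ->
  gaps_gf (c :: hs) = 1 + t * drop_sum c hs c.-1.
Proof.
elim: hs c => [|h hs IHhs] c chs.
  by rewrite drop_sum_nil /= mulr1 [LHS]word_gf_step.
rewrite drop_sum_cons // mulrDr addrCA -IHhs; last by case/andP: chs.
have -> : \sum_(p < gap c (h :: hs)) low_gf R p (c.-1 - h.+1 - p) =
    \sum_(p < gap c (h :: hs)) low_gf R p ((gap c (h :: hs)).-1 - p).
  by apply: eq_bigr => i _; congr low_gf => /=; lia.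
rewrite -[LHS]/(W (gap c (h :: hs)) * gaps_gf (h :: hs)) {1}word_gf_step; ring.
Qed.

Lemma drop_sum_top c hs : path gtn c hs ->
  t * drop_sum c hs c =
    t * (\sum_(p < gap c hs) low_gf R p (gap c hs - p)) * gaps_gf hs
    + gaps_gf hs - 1.
Proof.
case: hs => [|h hs] chs; first by rewrite drop_sum_nil /= mulr1 addrK.
rewrite drop_sum_cons // (drop_sumE (hs := hs)); last by case/andP: chs.
rewrite -[gap c (h :: hs)]/(c - h.+1)%N; set S := \sum_(p < _) _; ring.
Qed.

Lemma big_split_at (V : nmodType) (f : nat -> V) c hs n :
  path gtn c hs -> (c < n)%N ->
  \sum_(0 <= v < n | v \notin hs) f v =
    \sum_(0 <= v < c | v \notin hs) f v + f c + \sum_(d < n - c.+1) f (c.+1 + d)%N.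
Proof.
move=> chs lt_cn; rewrite (big_cat_nat (n := c.+1)) //=; congr (_ + _).
  rewrite big_mkcond big_nat_recr //= (path_gtn_notin chs) //=.
  by rewrite -big_mkcond.
rewrite -{1}[c.+1]add0n big_addn big_mkord; apply: eq_big => [i|i _].
  by rewrite (path_gtn_notin chs) //; lia.
by rewrite addnC.
Qed.

(** In [low_gf_step] times [gaps_gf hs] the constant term becomes [gaps_gf hs], which is 1 plus the
    drops into the lower gaps. *)
Lemma low_state_step c hs B : path gtn c hs -> (c <= B)%N ->
  low_state c hs B = 1 + t * \sum_(0 <= v < B.+1 | v \notin hs)
    low_state v (below (c :: hs) v) (if (v < c)%N then drop_bound hs v c else B).
Proof.
move=> chs cB; rewrite (big_split_at _ chs (cB : (c < B.+1)%N)) /= ltnn below_le // (below_all chs) //.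
rewrite (_ : \sum_(0 <= v < c | _) _ = drop_sum c hs c); last first.
  rewrite /drop_sum big_nat_cond [RHS]big_nat_cond; apply: eq_bigr => v.
  by case/andP=> /= vc _; rewrite vc below_le // ltnW.
rewrite !mulrDr drop_sum_top //.
rewrite (_ : \sum_(d < B.+1 - c.+1) _ =
  (\sum_(d < B - c) W (gap c hs) * low_gf R d ((B - c).-1 - d)) * gaps_gf hs).
  rewrite {1 2}/low_state {1}low_gf_step.
  set S := \sum_(d < _) _; set S2 := \sum_(p < _) _. ring.
rewrite subSS mulr_suml; apply: eq_bigr => d _.
rewrite (_ : (c.+1 + d < c)%N = false); last by lia.
rewrite (@below_all c.+1 (c :: hs)) /low_state ?leq_addr /= ?ltnSn //.
rewrite mulrA [low_gf _ _ _ * W _]mulrC; congr (_ * low_gf _ _ _ * _); lia.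
Qed.

Lemma high_state_step c hs n : path gtn c hs -> (c < n)%N ->
  high_state c hs (n - c.+1) = 1 + t * \sum_(0 <= v < n.+1 | v \notin hs)
    (if (v < c)%N then low_state v (below hs v) (drop_bound hs v c)
     else high_state v (below (c :: hs) v) (n - v)).
Proof.
move=> chs cn; rewrite (big_split_at _ chs (leqW cn)) /= ltnn below_le // (below_all chs) //.
rewrite (_ : \sum_(0 <= v < c | _) _ = drop_sum c hs c); last first.
  rewrite /drop_sum big_nat_cond [RHS]big_nat_cond; apply: eq_bigr => v.
  by case/andP=> /= vc _; rewrite vc.
rewrite !mulrDr drop_sum_top //.
have e1 : (n - c)%N = (n - c.+1).+1 by lia.
rewrite (_ : \sum_(d < n.+1 - c.+1) _ = (\sum_(d < (n - c.+1).+1)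
    W (gap c hs) * high_gf R d ((n - c.+1) - d)) * gaps_gf hs).
  rewrite e1 {1 2}/high_state {1}high_gf_step.
  set S := \sum_(d < _) _; set S2 := \sum_(p < _) _. ring.
rewrite subSS e1 mulr_suml; apply: eq_bigr => d _.
rewrite (_ : (c.+1 + d < c)%N = false); last by lia.
rewrite (@below_all c.+1 (c :: hs)) /high_state ?leq_addr /= ?ltnSn //.
rewrite mulrA [high_gf _ _ _ * W _]mulrC; congr (_ * high_gf _ _ _ * _); lia.
Qed.

End Separators.

#[global] Arguments low_state : simpl never.
#[global] Arguments high_state : simpl never.

(** * The automaton of avoiding words *)

Section Automaton.
Implicit Types (r hs : seq nat) (c v B : nat).

(* Words are stored reversed, so [r] lists the entries from last to first. *)
Fixpoint next_ok r u :=
  if r is c :: r' then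
    [&& next_ok r' u, ~~ ((u \in r') && (u < c)%N)
      & ~~ has (fun a => (c < a < u)%N) r']
  else true.

Fixpoint completions n r : nat :=
  if n is n'.+1 then
    (\sum_(0 <= v < (size r).+1 | next_ok r v) completions n' (v :: r))%N
  else 1%N.

(** Invariant linking a word to its state: on values up to [B] the state decides which letters may
    come next. It survives each further letter by [separated_up] and [separated_down]. *)
Definition separated r c hs B :=
  [/\ path gtn c hs, {subset c :: hs <= r},
      forall a, a \in r -> (a \in c :: hs) || (B <= a)%N
    & forall v, (v <= B)%N -> next_ok r v = (v \notin hs)].

Lemma separated_le r c hs B B' :
  (B <= B')%N -> separated r c hs B' -> separated r c hs B.
Proof.
move=> leB [chs hsr rB okr]; split=> // [a /rB/orP[->//|]|v vB].
  by move/(leq_trans leB) ->; rewrite orbT.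
exact: okr (leq_trans vB leB).
Qed.

Lemma mem_below q v h : (h \in below q v) = (h < v)%N && (h \in q).
Proof. exact: mem_filter. Qed.

Lemma path_below v q : sorted gtn q -> path gtn v (below q v).
Proof.
move=> sq; rewrite path_sortedE; last by move=> x y z /= xy yz; apply: ltn_trans yz xy.
rewrite filter_all sorted_filter //.
by move=> x y z /= xy yz; apply: ltn_trans yz xy.
Qed.

(** No entry lies strictly between [v] and [B], so 102 forbids nothing new up to [B]; 010 forbids
    the entries below [v], which include [c] once [c < v]. *)
Lemma separated_up r c hs B v : separated r c hs B -> (c <= v <= B)%N ->
  separated (v :: r) v (below (c :: hs) v) B.
Proof.
case=> chs hsr rB okr /andP[cv vB]; split.
- exact: path_below.
- move=> a; rewrite !in_cons mem_below => /orP[->//|/andP[_ /hsr ->]].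
  by rewrite orbT.
- move=> a; rewrite !in_cons => /orP[->//|/[dup] ar /rB /orP[ac|->]]; last first.
    by rewrite orbT.
  rewrite mem_below ac andbT.
  have : (a <= c)%N by move: ac; rewrite in_cons => /orP[/eqP->//|/(path_gtn_lt chs) /ltnW].
  by move=> /leq_trans/(_ cv); rewrite leq_eqVlt => ->.
move=> u uB; rewrite mem_below /= okr //.
rewrite [X in [&& _, _ & X]](_ : _ = true) ?andbT; last first.
  apply/hasPn => a /rB; rewrite in_cons -orbA => /or3P[/eqP->|ah|Ba].
  - by rewrite ltnNge cv.
  - by rewrite ltnNge (leq_trans (ltnW (path_gtn_lt chs ah)) cv).
  - by rewrite negb_and -!leqNgt (leq_trans uB Ba) orbT.
case: (ltnP u v) => [uv|vu]; last first.
  by rewrite andbF andbT (path_gtn_notin chs) // (leq_trans cv vu).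
rewrite andbT /= -negb_or; congr (~~ _).
have -> : (u \in r) = (u \in c :: hs).
  apply/idP/idP => [/rB/orP[//|]|/hsr//].
  by move=> Bu; move: (leq_trans uv (leq_trans vB Bu)); rewrite ltnn.
by rewrite in_cons; case: (u \in hs); rewrite ?orbT.
Qed.

(** The cases are a landing in the top gap and one in a lower gap; in the latter the successor of
    the bound is the least separator above [v]. *)
Lemma drop_boundP c hs v b : path gtn c hs -> v \notin hs ->
  (drop_bound hs v b = b /\ forall h, h \in hs -> (h < v)%N) \/
  [/\ (drop_bound hs v b).+1 \in hs, (v <= drop_bound hs v b)%N
    & forall h, h \in hs -> (v < h)%N -> (drop_bound hs v b < h)%N].
Proof.
elim: hs c b => [|g hs IHhs] c b; first by left.
rewrite [path _ _ _]/= => /andP[gc ghs]; rewrite in_cons negb_or => /andP[vg vhs].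
rewrite [drop_bound _ _ _]/=; case: ifP => [gv|/negbT]; first left.
  split=> // h; rewrite in_cons => /orP[/eqP->//|/(path_gtn_lt ghs) hg].
  exact: ltn_trans hg gv.
rewrite -leqNgt leq_eqVlt (negPf vg) /= => {vg} vg; right.
have gK : g.-1.+1 = g by rewrite prednK // (leq_ltn_trans _ vg).
case: (IHhs g g.-1 ghs vhs) => [[-> hv]|[dh vd hd]]; split.
- by rewrite gK mem_head.
- by rewrite -ltnS gK.
- move=> h; rewrite in_cons gK => /orP[/eqP->//|/hv hlt /(ltn_trans hlt)].
  by rewrite ltnn.
- by rewrite in_cons dh orbT.
- by [].
- move=> h; rewrite in_cons => /orP[/eqP-> _|]; last exact: hd.
  exact: ltnW (path_gtn_lt ghs dh).
Qed.

(** After the drop, any earlier entry above [v] is the first entry of a potential 102 and caps the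
    later letters: [c] does so in the top gap, the next separator in a lower one. *)
Lemma separated_down r c hs B v (b := drop_bound hs v c) :
  separated r c hs B -> (v < c <= B)%N -> v \notin hs ->
  [/\ separated (v :: r) v (below hs v) b, (v <= b <= c)%N
    & forall u, next_ok (v :: r) u -> (u <= b)%N].
Proof.
case=> chs hsr rB okr /andP[vc cB] vhs.
have bP := drop_boundP c chs vhs; rewrite -/b in bP.
have vbc : (v <= b <= c)%N.
  case: bP => [[-> _]|[bh -> _]]; first by rewrite ltnW /=.
  exact: ltnW (ltnW (path_gtn_lt chs bh)).
have [vb bc] := andP vbc.
have rv a : a \in r -> (a <= v)%N || (b <= a)%N.
  move=> /rB; rewrite in_cons -orbA => /or3P[/eqP->|ah|Ba].
  - by rewrite bc orbT.
  - case: leqP => //= va; case: bP => [[_ hv]|[_ _ hb]].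
      by move: (ltn_trans va (hv _ ah)); rewrite ltnn.
    exact: ltnW (hb _ ah va).
  - by rewrite (leq_trans bc (leq_trans cB Ba)) orbT.
have rh a : a \in r -> (a <= v)%N -> a \in hs.
  move=> /rB; rewrite in_cons -orbA => /or3P[/eqP->|//|Ba].
    by rewrite leqNgt vc.
  by move/(leq_trans Ba)/(leq_trans cB); rewrite leqNgt vc.
split=> //; first split.
- by apply: path_below; apply: path_sorted chs.
- move=> a; rewrite !in_cons mem_below => /orP[->//|/andP[_ ah]].
  by rewrite hsr ?orbT // in_cons ah orbT.
- move=> a; rewrite !in_cons => /orP[->//|ar].
  case/orP: (rv _ ar) => [av|->]; last by rewrite orbT.
  rewrite mem_below (rh _ ar av) andbT.
  by move: av; rewrite leq_eqVlt => ->.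
- move=> u ub; rewrite mem_below /= okr ?(leq_trans ub (leq_trans bc cB)) //.
  rewrite [X in [&& _, _ & X]](_ : _ = true) ?andbT; last first.
    apply/hasPn => a /rv/orP[av|ba]; rewrite negb_and -!leqNgt ?av //.
    by rewrite (leq_trans ub ba) orbT.
  case: (ltnP u v) => [uv|vu] /=.
    rewrite andbT; case: (boolP (u \in hs)) => //= uh; apply/negP.
    by move=> /rh; rewrite (ltnW uv) (negPf uh) => /(_ isT).
  rewrite andbF andbT; apply/negP => uh.
  move: vu; rewrite leq_eqVlt => /orP[/eqP vu|vu]; first by rewrite vu uh in vhs.
  case: bP => [[_ hv]|[_ _ hb]].
    by move: (ltn_trans vu (hv _ uh)); rewrite ltnn.
  by move: (leq_trans (hb _ uh vu) ub); rewrite ltnn.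
move=> u /= /and3P[oku _ /hasPn nu]; rewrite leqNgt; apply/negP => bu.
have {}nu a : a \in r -> (v < a)%N -> (u <= a)%N.
  move=> /nu; rewrite negb_and -!leqNgt => /orP[av|//] va.
  by move: (leq_trans va av); rewrite ltnn.
case: bP => [[bE _]|[bh _ _]].
  by move: (leq_trans bu (nu c (hsr _ (mem_head _ _)) vc)); rewrite bE ltnn.
have bS : b.+1 \in r by rewrite hsr // in_cons bh orbT.
(* The pattern 102 still allows the separator [b.+1] itself, but [next_ok r] already excludes it. *)
have uE : u = b.+1 by apply/eqP; rewrite eqn_leq bu nu.
move: oku; rewrite uE okr ?bh //.
exact: leq_trans (ltnW (path_gtn_lt chs bh)) cB.
Qed.

Variable R : comNzRingType.

Lemma coef_step (f g : fps R) n :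
  f = 1 + fps_var R * g -> fps_coef f n = if n is m.+1 then fps_coef g m else 1.
Proof.
by move->; rewrite fps_coefD fps_coef_varM; case: n => [|n] /=; rewrite ?addr0 ?add0r.
Qed.

(** No admissible letter exceeds [B], and [B <= size r], so the diagonal bound is inactive and the
    state alone matters. *)
Lemma completions_low n r c hs B : separated r c hs B ->
  (forall v, next_ok r v -> (v <= B)%N) -> (c <= B <= size r)%N ->
  (completions n r)%:R = fps_coef (low_state R c hs B) n.
Proof.
elim: n r c hs B => [|n IHn] r c hs B sep okB /andP[cB Br].
  by case: (sep) => chs _ _ _; rewrite (coef_step _ (low_state_step R chs cB)).
case: (sep) => chs hsr rB okr.
rewrite (coef_step _ (low_state_step R chs cB)) fps_coef_sum /= natr_sum.
rewrite [RHS](@big_nat_widen _ _ _ _ _ (size r).+1) ?ltnS //.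
apply: eq_big => [v|v okv].
  rewrite ltnS; case: leqP => vB; first by rewrite okr // andbT.
  by rewrite andbF; apply/negP => /okB; rewrite leqNgt vB.
have vB := okB _ okv; have vhs : v \notin hs by rewrite -okr.
case: ltnP => [vc|cv]; last first.
  have vBr : (v <= B <= size (v :: r))%N by rewrite vB /= leqW.
  apply: IHn vBr; first by apply: separated_up sep _; rewrite cv vB.
  by move=> u /= /and3P[/okB].
rewrite below_le ?(ltnW vc) //.
have [sep' /andP[vb bc] okb] := separated_down sep (introT andP (conj vc cB)) vhs.
apply: IHn => //; rewrite vb (leq_trans bc) //.
by rewrite leqW // (leq_trans cB Br).
Qed.

(** Separation for every [B] means that the patterns set no upper limit yet, only the position does.
    The first descent hands over to [completions_low]. *)
Lemma completions_high n r c hs : (forall B, separated r c hs B) ->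
  (c < size r)%N ->
  (completions n r)%:R = fps_coef (high_state R c hs (size r - c.+1)) n.
Proof.
elim: n r c hs => [|n IHn] r c hs sep cr; case: (sep 0%N) => chs _ _ _.
  by rewrite (coef_step _ (high_state_step R chs cr)).
rewrite (coef_step _ (high_state_step R chs cr)) fps_coef_sum /= natr_sum.
have okr v : next_ok r v = (v \notin hs) by case: (sep v) => _ _ _ ->.
rewrite big_nat_cond [RHS]big_nat_cond; apply: eq_big => [v|v].
  by rewrite okr.
rewrite okr => /andP[/= vr vhs]; case: ltnP => [vc|cv]; last first.
  (* [separated_up] needs [v] within the bound, hence the detour through [maxn B v]. *)
  apply: IHn => //= B; apply: separated_le (leq_maxl B v) _.
  by apply: separated_up => //; rewrite cv leq_maxr.
have [sep' /andP[vb bc] okb] :=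
  separated_down (sep c) (introT andP (conj vc (leqnn c))) vhs.
apply: completions_low => //; rewrite vb (leq_trans bc) //.
by rewrite ltnW // leqW.
Qed.

(** The first letter is 0, with excess 0; moreover [W 1] is 1/(1 - t) and [W 0] is 1. *)
Lemma completions_nil n :
  (completions n [::])%:R =
  fps_coef (1 + fps_var R * (fps_geom R + climb_gf R 0)) n.
Proof.
rewrite (coef_step _ (erefl _)); case: n => [//|n].
rewrite [completions _ _]/= big_nat1 (completions_high n (c := 0) (hs := [::])) // => [|B].
  rewrite /high_state [gaps_gf _ _]/= mulr1 /high_gf; congr (fps_coef (_ + _) n).
    have W1 : (1 - fps_var R) * word_gf R 1 = 1.
      rewrite mulrBl mul1r {1}word_gfE /= !big_ord1 [word_gf R 0]word_gfE /=.
      by rewrite subrr !mulr0 addr0 addrK.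
    by rewrite -[LHS]mul1r -(fps_geomP R) mulrAC W1 mul1r.
  by rewrite [word_gf R 0]word_gfE mul1r.
by split=> // a; rewrite in_cons => /orP[/eqP->|//].
Qed.
End Automaton.

(** * From finite functions to avoiding words *)

Section Enumeration.
Local Open Scope nat_scope.
Implicit Types (w r : seq nat).

Fixpoint avoiding r :=
  if r is v :: r' then [&& avoiding r', v <= size r' & next_ok r' v] else true.

Definition next_letters r := [seq v <- iota 0 (size r).+1 | next_ok r v].
Arguments next_letters : simpl never.

Lemma mem_next_letters r v : (v \in next_letters r) = (v <= size r) && next_ok r v.
Proof. by rewrite mem_filter mem_iota andbC. Qed.

Fixpoint avoiding_words n : seq (seq nat) :=
  if n is n'.+1 then
    [seq v :: r | r <- avoiding_words n', v <- next_letters r]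
  else [:: [::]].

Lemma mem_avoiding_words n r : (r \in avoiding_words n) = (size r == n) && avoiding r.
Proof.
elim: n r => [|n IHn] [|v r] //=.
  by apply/negP => /allpairsPdep[r [v []]].
apply/allpairsPdep/idP => [[r' [v' [r'n v'r [-> ->]]]]|].
  move: r'n v'r; rewrite IHn mem_next_letters => /andP[/eqP <- ->].
  by rewrite eqxx.
rewrite eqSS => /and4P[/eqP rn ar vr okv]; exists r, v.
by rewrite IHn mem_next_letters rn eqxx ar okv -rn vr.
Qed.

Lemma avoiding_words_uniq n : uniq (avoiding_words n).
Proof.
elim: n => //= n IHn; apply: allpairs_uniq_dep => // [r _|].
  by rewrite filter_uniq ?iota_uniq.
by move=> [r v] [r' v'] _ _ /= [-> ->].
Qed.

Lemma size_avoiding_words n m :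
  \sum_(r <- avoiding_words m) completions n r = size (avoiding_words (m + n)).
Proof.
elim: n m => [|n IHn] m; first by rewrite addn0 sum1_size.
rewrite addnS -addSn -IHn /= big_allpairs_dep /=.
by apply: eq_bigr => r _; rewrite [RHS]big_filter.
Qed.

Definition forbidden x y z := (x == z) && (x < y) || (y < x < z).

(** Each level of [next_ok] treats the pairs whose second member is the head letter, so the
    recursion covers all pairs. *)
Lemma next_okP w u : next_ok (rev w) u <->
  forall a b, a < b < size w -> ~~ forbidden (nth 0 w a) (nth 0 w b) u.
Proof.
elim/last_ind: w => [|w c IHw]; first by split=> // _ a b; rewrite andbC.
rewrite rev_rcons /= size_rcons; split.
  move=> /and3P[/IHw okw uw hw] a b /andP[ab]; rewrite ltnS leq_eqVlt.
  rewrite !nth_rcons => /orP[/eqP bE|bw]; last first.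
    by rewrite (ltn_trans ab bw) bw okw // ab bw.
  rewrite bE ltnn eqxx -bE ab; have aw : nth 0 w a \in rev w.
    by rewrite mem_rev mem_nth // -bE.
  rewrite /forbidden negb_or (hasPn hw) // andbT.
  by apply: contra uw => /andP[/eqP <- ->]; rewrite aw.
move=> H; apply/and3P; split.
- apply/IHw => a b /andP[ab bw].
  have := H a b; rewrite !nth_rcons bw (ltn_trans ab bw) ab ltnS ltnW //.
  by apply.
- apply/negP => /andP[]; rewrite mem_rev => /(nthP 0)[a aw au] uc.
  have := H a (size w); rewrite !nth_rcons aw ltnn eqxx ltnSn /forbidden au eqxx uc.
  by move/(_ isT).
apply/hasPn => x; rewrite mem_rev => /(nthP 0)[a aw <-].
have := H a (size w); rewrite !nth_rcons aw ltnn eqxx ltnSn /forbidden negb_or.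
by move/(_ isT)/andP => [].
Qed.

Lemma avoidingP w : avoiding (rev w) <->
  (forall i, i < size w -> nth 0 w i <= i) /\
  (forall a b c, a < b < c -> c < size w ->
     ~~ forbidden (nth 0 w a) (nth 0 w b) (nth 0 w c)).
Proof.
elim/last_ind: w => [|w u IHw]; first by split.
rewrite rev_rcons /= size_rcons size_rev; split.
  move=> /and3P[/IHw[le_w ok_w] uw /next_okP oku]; split=> [i|a b c /andP[ab bc]].
    rewrite ltnS leq_eqVlt nth_rcons => /orP[/eqP->|iw]; first by rewrite ltnn eqxx.
    by rewrite iw le_w.
  rewrite ltnS leq_eqVlt !nth_rcons => /orP[/eqP cE|cw].
    by rewrite cE ltnn eqxx -cE (ltn_trans ab bc) bc oku // ab -cE.
  by rewrite cw (ltn_trans bc cw) (ltn_trans ab (ltn_trans bc cw)) ok_w // ab.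
move=> [le_w ok_w]; apply/and3P; split.
- apply/IHw; split=> [i iw|a b c /andP[ab bc] cw].
    by have := le_w i; rewrite nth_rcons iw ltnS ltnW // => /(_ isT).
  have := ok_w a b c; rewrite !nth_rcons cw (ltn_trans bc cw).
  by rewrite (ltn_trans ab (ltn_trans bc cw)) ab bc ltnS ltnW //; apply.
- by have := le_w (size w) (ltnSn _); rewrite nth_rcons ltnn eqxx.
apply/next_okP => a b /andP[ab bw].
have := ok_w a b (size w); rewrite !nth_rcons bw (ltn_trans ab bw) ltnn eqxx ab.
by apply.
Qed.

Section Ffun.
Variable n : nat.
Implicit Type s : {ffun 'I_n -> 'I_n}.

Definition ffun_word s : seq nat := [seq val (s i) | i <- enum 'I_n].

Lemma size_ffun_word s : size (ffun_word s) = n.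
Proof. by rewrite size_map size_enum_ord. Qed.

Lemma nth_ffun_word s (i : 'I_n) : nth 0 (ffun_word s) i = s i.
Proof. by rewrite (nth_map i) ?size_enum_ord // nth_ord_enum. Qed.

Lemma ffun_word_inj : injective (rev \o ffun_word).
Proof.
move=> s s' /= /(can_inj revK) eq_s; apply/ffunP => i; apply: val_inj.
by rewrite /= -!nth_ffun_word eq_s.
Qed.

Lemma avoiding_ffun_word s : avoiding (rev (ffun_word s)) =
  [&& inversion_seq s, ~~ contains010 s & ~~ contains102 s].
Proof.
apply/idP/and3P => [/avoidingP|[/forallP inv n010 n102]].
  rewrite size_ffun_word => -[le_s ok_s].
  have oks (a b c : 'I_n) : a < b < c -> ~~ forbidden (s a) (s b) (s c).
    by move=> abc; rewrite -!nth_ffun_word ok_s.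
  split; first by apply/forallP => i; rewrite -nth_ffun_word le_s.
    apply/negP => /existsP[a /existsP[b /existsP[c /and4P[ab bc /eqP sac sab]]]].
    have := oks a b c; rewrite ab bc /forbidden -sac eqxx sab.
    by move/(_ isT).
  apply/negP => /existsP[a /existsP[b /existsP[c /and4P[ab bc sba sac]]]].
  by have := oks a b c; rewrite ab bc /forbidden sba sac orbT => /(_ isT).
apply/avoidingP; rewrite size_ffun_word; split=> [i lt_in|a b c /andP[ab bc] cn].
  by have := inv (Ordinal lt_in); rewrite -nth_ffun_word.
have bn := ltn_trans bc cn; have an := ltn_trans ab bn.
rewrite -[a]/(val (Ordinal an)) -[b]/(val (Ordinal bn)) -[c]/(val (Ordinal cn)).
rewrite !nth_ffun_word; apply/norP; split.
  apply: contra n010 => /andP[sac sab]; apply/existsP; exists (Ordinal an).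
  apply/existsP; exists (Ordinal bn); apply/existsP; exists (Ordinal cn).
  by rewrite /= ab bc sab andbT.
apply: contra n102 => /andP[sba sac]; apply/existsP; exists (Ordinal an).
apply/existsP; exists (Ordinal bn); apply/existsP; exists (Ordinal cn).
by rewrite /= ab bc sba.
Qed.

Lemma count_avoidingE : count_avoiding n = completions n [::].
Proof.
have := size_avoiding_words n 0; rewrite big_seq1 add0n => ->.
rewrite /count_avoiding cardE -(size_map (rev \o ffun_word)).
apply: perm_size; apply: uniq_perm.
- by rewrite (map_inj_uniq ffun_word_inj) enum_uniq.
- exact: avoiding_words_uniq.
move=> r; rewrite mem_avoiding_words; apply/mapP/andP => [[s]|[/eqP rn ar]].
  rewrite mem_enum inE -avoiding_ffun_word => as_ -> /=.
  by rewrite size_rev size_ffun_word eqxx.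
have /avoidingP[] : avoiding (rev (rev r)) by rewrite revK.
rewrite size_rev rn => le_r _.
pose s : {ffun 'I_n -> 'I_n} := [ffun i : 'I_n => insubd i (nth 0 (rev r) i)].
have sE : ffun_word s = rev r.
  apply: (@eq_from_nth _ 0) => [|i]; rewrite size_ffun_word ?size_rev // => lt_in.
  rewrite -[i in LHS]/(val (Ordinal lt_in)) nth_ffun_word ffunE val_insubd.
  by rewrite (leq_ltn_trans (le_r i lt_in) lt_in).
exists s; last by rewrite /= sE revK.
by rewrite mem_enum inE -avoiding_ffun_word sE revK.
Qed.
End Ffun.
End Enumeration.

(** * The kernel method *)

(* [u], [d], [z], [h], [h'] are the values at the kernel root [X] of U, (U - 1)/x,
   1/(1 - x), H, (H - H_0)/x, and [c] is 1/(1 - t). *)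
Lemma elimination (R : idomainType) (t c X u d z h h' H0 F : R) :
  t != 0 -> X != 0 -> 1 - X != 0 -> (1 - t) * c = 1 -> (1 - X) * z = 1 ->
  u = 1 + X * d -> d = z + t * (z * d) + t * c * (u * (u - z)) ->
  h = H0 + X * h' -> h = t * (h' + z * d + u * h) -> X = t * (1 + X * u) ->
  F = 1 + t * (c + H0) ->
  (t ^+ 5 - 3 * t ^+ 4 + 4 * t ^+ 3 - 3 * t ^+ 2 + t) * F ^+ 3
   + (4 * t ^+ 4 - 8 * t ^+ 3 + 6 * t ^+ 2 - 2 * t) * F ^+ 2
   + (- t ^+ 4 + 8 * t ^+ 3 - 11 * t ^+ 2 + 6 * t - 1) * F
   + (- 2 * t ^+ 3 + 5 * t ^+ 2 - 4 * t + 1) = 0.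
Proof.
move=> t0 X0 X1 cE zE uE dE hE hE' XE FE.
set P := (LHS).
have subE (x y : R) : x = y -> x - y = 0 by move=> ->; rewrite subrr.
move: cE zE uE dE hE hE' XE FE => /subE cE /subE zE /subE uE /subE dE /subE hE.
move=> /subE hE' /subE XE FE'.
have t1 : 1 - t != 0.
  by apply/eqP => t1; move: cE; rewrite t1 mul0r sub0r => /eqP; rewrite oppr_eq0 oner_eq0.
(* This affine image of [F] is a multiple of the unknown [H0]. *)
pose a := (1 - t) * F - 1.
have aE : a = t * (1 - t) * H0.
  have : a - t * (1 - t) * H0 = t * ((1 - t) * c - 1) by rewrite /a FE'; ring.
  by rewrite cE mulr0 => /eqP; rewrite subr_eq0 => /eqP.
(* At the root of the kernel the unknown [h] drops out. *)
have H0E : (1 - X) * H0 = u - 1.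
  apply/eqP; rewrite -subr_eq0 -(mulrI_eq0 _ (mulfI t0)); apply/eqP.
  transitivity (t * (X * d * ((1 - X) * z - 1) - (u - (1 + X * d)))
    + (1 - X) * (X * (h - t * (h' + z * d + u * h)) 
       - t * (h - (H0 + X * h')) - h * (X - t * (1 + X * u)))); first by ring.
  by rewrite zE uE hE hE' XE; ring.
have tXu : t * X * u = X - t.
  by apply/eqP; rewrite -subr_eq0 -oppr_eq0 -XE; apply/eqP; ring.
(* The quadratic equation of U at [X], cleared of [d], [z] and [c]. *)
have quad : (u * (1 - X) - 1) * (1 - t - t * X * u) = t * (1 - t) * (u - 1).
  apply/eqP; rewrite -subr_eq0; apply/eqP.
  transitivity (X * (1 - X) * (1 - t) * (d - (z + t * (z * d) + t * c * (u * (u - z))))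
    + (1 - t) * (1 - X) * (1 - t * z) * (u - (1 + X * d))
    + ((1 - t) * (X + t * (u - 1)) - t * X * u) * ((1 - X) * z - 1)
    + t * X * u * (1 - X) * (u - z) * ((1 - t) * c - 1)); first by ring.
  by rewrite dE uE zE cE; ring.
(* Replacing [u] through [tXu] leaves two relations between [X], [a] and [t]: [E1] and [E2]. *)
have E1 : X - X ^+ 2 - t = t * X * a.
  apply: (mulIf X1); rewrite aE.
  transitivity (t * X * (t * (1 - t) * ((1 - X) * H0))); last by ring.
  rewrite H0E -quad.
  transitivity ((t * X * u * (1 - X) - t * X) * (1 - t - t * X * u)); last by ring.
  by rewrite tXu; ring.
have E2 : a * (1 - X) = (1 - t) * (t * a + X - t).
  apply: (mulIf X0).
  transitivity ((1 - t) * (t * X * a + X ^+ 2 - t * X)); last by ring.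
  transitivity (t * (1 - t) * ((1 - X) * H0) * X); first by rewrite aE; ring.
  rewrite H0E -E1.
  by transitivity ((1 - t) * (t * X * u - t * X)); [ring | rewrite tXu; ring].
(* [E2] is linear in [X] with coefficient [D], so multiplying [E1] by [D ^+ 2] eliminates [X]; this
   leaves [P] up to sign and the factor [1 - t]. *)
pose D := a + 1 - t.
have XD : X * D = a - t * (1 - t) * a + t * (1 - t).
  apply/eqP; rewrite -subr_eq0; apply/eqP.
  transitivity ((1 - t) * (t * a + X - t) - a * (1 - X)); first by rewrite /D; ring.
  by rewrite E2 subrr.
have : (1 - t) * P = 0.
  transitivity (- (X * D * D * (1 - t * a) - (X * D) ^+ 2 - t * D ^+ 2)).
    by rewrite XD /D /P /a; ring.
  transitivity (- D ^+ 2 * (X - X ^+ 2 - t - t * X * a)); first by ring.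
  by rewrite E1 subrr mulr0.
by move/eqP; rewrite mulf_eq0 (negPf t1) => /eqP.
Qed.

Section Kernel.
Variable R : idomainType.
Local Notation t := (fps_var R).
Local Notation W := (word_gf R).
Local Notation H := (climb_gf R).
Local Notation S := (fps R).

Definition words_bigf : fps S := Fps W.

(** [fps_fix] solves for families of series, hence the index type [unit]. *)
Definition kernel_op (X : unit -> S) (i : unit) : S :=
  t * (1 + X i * fps_eval (X i) words_bigf).

Definition kernel_root : S := fps_fix kernel_op tt.
Local Notation X := kernel_root.

Lemma kernel_rootE : X = t * (1 + X * fps_eval X words_bigf).
Proof.
apply: (fps_fixE (T := kernel_op)) => n f g fg i.
apply: fps_eqmod_varM; apply: fps_eqmodD; first by [].
apply: fps_eqmodM; first exact: fg.
by apply: fps_eqmod_eval; apply: fg.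
Qed.

Lemma kernel_root0 : fps_coef X 0 = 0.
Proof. by rewrite kernel_rootE fps_coef_varM. Qed.

(** The recursions of [W] and [H] become equations between series in a further variable [x]; since
    [X] has constant term 0, they can be evaluated at [X], which yields the hypotheses of
    [elimination]. *)
Lemma avoiding_cubic (F : S) : F = 1 + t * (fps_geom R + H 0) ->
  (t ^+ 5 - 3 * t ^+ 4 + 4 * t ^+ 3 - 3 * t ^+ 2 + t) * F ^+ 3
   + (4 * t ^+ 4 - 8 * t ^+ 3 + 6 * t ^+ 2 - 2 * t) * F ^+ 2
   + (- t ^+ 4 + 8 * t ^+ 3 - 11 * t ^+ 2 + 6 * t - 1) * F
   + (- 2 * t ^+ 3 + 5 * t ^+ 2 - 4 * t + 1) = 0.
Proof.
pose U := words_bigf; pose D : fps S := Fps (fun k => W k.+1).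
pose G : fps S := Fps H; pose G' : fps S := Fps (fun k => H k.+1).
pose Z := fps_geom S; pose x := fps_var S.
pose k (a : S) : fps S := fps_of_poly a%:P.
have UE : U = 1 + x * D.
  by rewrite {1}[U]fps_head_tail /= word_gfE polyC1 rmorph1.
(* Partial sums become products with [Z], which is 1/(1 - x), and convolutions become products with
   [U]. *)
have DE : D = Z + k t * (Z * D) + k (t * fps_geom R) * (U * (U - Z)).
  apply: fpsP => n; rewrite !fps_coefD !fps_coef_constM fps_coef_geomM.
  rewrite [LHS]/= word_gfE /= mulrDr addrA mulrA.
  by congr (_ + _ * _).
have GE : G = k (H 0) + x * G' by rewrite {1}[G]fps_head_tail.
have GE' : G = k t * (G' + Z * D + U * G).
  apply: fpsP => n; rewrite fps_coef_constM !fps_coefD fps_coef_geomM.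
  by rewrite [LHS]/= climb_gfE /climb_op big_split /= addrA.
have eD := fps_evalD; have eM := fps_evalM kernel_root0.
have eX : fps_eval X x = X by rewrite (fps_eval_poly kernel_root0) hornerX.
have ek a : fps_eval X (k a) = a by rewrite (fps_eval_poly kernel_root0) hornerC.
have e1 : fps_eval X 1 = 1.
  by rewrite -(rmorph1 (@fps_of_poly S)) (fps_eval_poly kernel_root0) hornerC.
have eB a b : fps_eval X (a - b) = fps_eval X a - fps_eval X b.
  by apply/eqP; rewrite eq_sym subr_eq -eD subrK.
have XE : X = t * (1 + X * fps_eval X U) := kernel_rootE.
have ZE : (1 - x) * Z = 1 := fps_geomP S.
clearbody U D Z G G' x k; move=> FE; pose ev := fps_eval X.
apply: (@elimination _ t (fps_geom R) X (ev U) (ev D) (ev Z) (ev G) (ev G') (H 0)).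
- apply/eqP => /(congr1 (fun f => fps_coef f 1)) /eqP.
  by rewrite /= coefX oner_eq0.
- apply/eqP => X0; have := kernel_rootE; rewrite X0 mul0r addr0 mulr1.
  by move/(congr1 (fun f => fps_coef f 1)) => /eqP; rewrite /= coefX eq_sym oner_eq0.
- apply/eqP => /(congr1 (fun f => fps_coef f 0)) /eqP.
  rewrite fps_coefD -[fps_coef (- X) 0]/(- fps_coef X 0) kernel_root0 subr0.
  by rewrite oner_eq0.
- exact: fps_geomP.
- have -> : 1 - X = ev (1 - x) by rewrite /ev eB e1 eX.
  by rewrite -eM ZE.
- by rewrite {1}UE /ev eD eM eX e1.
- by rewrite {1}DE /ev !eD !eM !ek eB.
- by rewrite {1}GE /ev eD eM eX ek.
- rewrite {1}GE' /ev eM ek !eD 2!eM; reflexivity.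
- exact: XE.
- exact: FE.
Qed.
End Kernel.

(** * Minimality *)

(** Homogeneous, so that a root in a fraction field becomes a zero over the ring, free of
    denominators. *)
Definition binary_cubic (A : comNzRingType) (c3 c2 c1 c0 a b : A) :=
  c3 * a ^+ 3 + c2 * (a ^+ 2 * b) + c1 * (a * b ^+ 2) + c0 * b ^+ 3.

Lemma rmorph_binary_cubic (A B : comNzRingType) (f : {rmorphism A -> B})
    c3 c2 c1 c0 a b :
  f (binary_cubic c3 c2 c1 c0 a b) =
    binary_cubic (f c3) (f c2) (f c1) (f c0) (f a) (f b).
Proof. by rewrite /binary_cubic !(rmorphD, rmorphXn, rmorphM). Qed.

(** The constants are the coefficients of the cubic at t = -1. All 25 pairs are checked. *)
Lemma binary_cubic_F5 (a b : 'F_5) :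
  binary_cubic (- 12%:R) 20%:R (- 27%:R) 12%:R a b = 0 -> a = 0 /\ b = 0.
Proof.
have -> : 20%:R = 0 :> 'F_5 by apply: val_inj.
have -> : 27%:R = 2 :> 'F_5 by apply: val_inj.
have -> : 12%:R = 2 :> 'F_5 by apply: val_inj.
by case: a => [[|[|[|[|[|?]]]]] ?] //; case: b => [[|[|[|[|[|?]]]]] ?] //;
  move=> /(congr1 val) //= _; split; apply: val_inj.
Qed.

(** A zero would make both coprime arguments divisible by 5. *)
Lemma binary_cubic_int (a b : int) : coprime `|a| `|b| ->
  binary_cubic (- 12%:R) 20%:R (- 27%:R) 12%:R a b != 0.
Proof.
move=> co; apply/eqP => /(congr1 (intr : int -> 'F_5)).
rewrite rmorph_binary_cubic !rmorphN !rmorph_nat rmorph0.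
move=> /binary_cubic_F5[a0 b0].
have c5 : 5%N \in [pchar 'F_5] by apply: pchar_Fp.
have : (5 %| gcdn `|a| `|b|)%N.
  rewrite dvdn_gcd; apply/andP; split.
    by have := dvdz_pcharf c5 a; rewrite a0 eqxx.
  by have := dvdz_pcharf c5 b; rewrite b0 eqxx.
by rewrite (eqP co).
Qed.

Lemma binary_cubic_rat (y z : rat) :
  binary_cubic (- 12%:R) 20%:R (- 27%:R) 12%:R y z = 0 -> y = 0 /\ z = 0.
Proof.
have [->|z0 yz] := eqVneq z 0.
  rewrite /binary_cubic !expr0n /= !mulr0 !addr0 => /eqP.
  by rewrite mulf_eq0 expf_eq0 => /eqP.
pose a := numq (y / z); pose b := denq (y / z).
have b0 : b%:~R != 0 :> rat by rewrite intr_eq0 denq_neq0.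
have yE : y * b%:~R = z * a%:~R.
  have := divq_num_den (y / z); rewrite -/a -/b => E.
  by apply/eqP; rewrite [z * _]mulrC -eqr_div // E.
have := binary_cubic_int (coprime_num_den (y / z)); rewrite -/a -/b.
rewrite -(intr_eq0 rat) rmorph_binary_cubic !rmorphN !rmorph_nat => /eqP[].
apply: (mulfI (expf_neq0 3 z0)); rewrite mulr0 -(mulr0 (b%:~R ^+ 3)) -yz.
move: yE; rewrite /binary_cubic; set u := a%:~R; set v := b%:~R => yE.
transitivity (- 12%:R * (z * u) ^+ 3 + 20%:R * ((z * u) ^+ 2 * (z * v))
  - 27%:R * ((z * u) * (z * v) ^+ 2) + 12%:R * (z * v) ^+ 3); first by ring.
by rewrite -yE; ring.
Qed.

Lemma binary_cubicM (A : comNzRingType) (c3 c2 c1 c0 a b l : A) :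
  binary_cubic c3 c2 c1 c0 (a * l) (b * l) =
    binary_cubic c3 c2 c1 c0 a b * l ^+ 3.
Proof. by rewrite /binary_cubic; ring. Qed.

(** Stated over any ring, as [t] stands in turn for a rational function, a power series and -1. *)
Definition cubic_coef3 (A : comNzRingType) (t : A) :=
  t ^+ 5 - 3 * t ^+ 4 + 4 * t ^+ 3 - 3 * t ^+ 2 + t.
Definition cubic_coef2 (A : comNzRingType) (t : A) :=
  4 * t ^+ 4 - 8 * t ^+ 3 + 6 * t ^+ 2 - 2 * t.
Definition cubic_coef1 (A : comNzRingType) (t : A) :=
  - t ^+ 4 + 8 * t ^+ 3 - 11 * t ^+ 2 + 6 * t - 1.
Definition cubic_coef0 (A : comNzRingType) (t : A) :=
  - 2 * t ^+ 3 + 5 * t ^+ 2 - 4 * t + 1.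

Definition rmorph_coef := (rmorphD, rmorphN, rmorph_nat, rmorphXn, rmorphM, rmorph1).

Lemma rmorph_cubic_coef3 (A B : comNzRingType) (f : {rmorphism A -> B}) t :
  f (cubic_coef3 t) = cubic_coef3 (f t).
Proof. by rewrite /cubic_coef3 !rmorph_coef. Qed.
Lemma rmorph_cubic_coef2 (A B : comNzRingType) (f : {rmorphism A -> B}) t :
  f (cubic_coef2 t) = cubic_coef2 (f t).
Proof. by rewrite /cubic_coef2 !rmorph_coef. Qed.
Lemma rmorph_cubic_coef1 (A B : comNzRingType) (f : {rmorphism A -> B}) t :
  f (cubic_coef1 t) = cubic_coef1 (f t).
Proof. by rewrite /cubic_coef1 !rmorph_coef. Qed.
Lemma rmorph_cubic_coef0 (A B : comNzRingType) (f : {rmorphism A -> B}) t :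
  f (cubic_coef0 t) = cubic_coef0 (f t).
Proof. by rewrite /cubic_coef0 !rmorph_coef. Qed.

Definition cubic_form (A : comNzRingType) (t a b : A) :=
  binary_cubic (cubic_coef3 t) (cubic_coef2 t) (cubic_coef1 t) (cubic_coef0 t) a b.

Lemma rmorph_cubic_form (A B : comNzRingType) (f : {rmorphism A -> B}) t a b :
  f (cubic_form t a b) = cubic_form (f t) (f a) (f b).
Proof.
by rewrite rmorph_binary_cubic rmorph_cubic_coef3 rmorph_cubic_coef2 rmorph_cubic_coef1 rmorph_cubic_coef0.
Qed.

(* Specialising [t := -1] and reducing modulo 5 leaves a form without nontrivial
   zeros, so any zero over [rat[X]] is divisible by ['X + 1] arbitrarily often. *)
Lemma cubic_form_poly (a b : {poly rat}) : cubic_form 'X a b = 0 -> b = 0.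
Proof.
have [n] := ubnP (size b); elim: n a b => // n IHn a b /ltnSE le_b ab0.
apply/eqP; apply/contraT => b0.
have := congr1 (horner_eval (- 1)) ab0.
rewrite rmorph_cubic_form rmorph0 /= /horner_eval hornerX /cubic_form.
rewrite (_ : cubic_coef3 _ = - 12%:R) 1?(_ : cubic_coef2 _ = 20%:R); try by rewrite /cubic_coef3 /cubic_coef2; ring.
rewrite (_ : cubic_coef1 _ = - 27%:R) 1?(_ : cubic_coef0 _ = 12%:R); try by rewrite /cubic_coef1 /cubic_coef0; ring.
case/binary_cubic_rat => /rootP/factor_theorem[a' aE] /rootP/factor_theorem[b' bE].
have l0 := polyXsubC_eq0 (- 1 : rat).
move: ab0 b0 le_b; rewrite aE bE /cubic_form binary_cubicM => /eqP.
rewrite mulf_eq0 expf_eq0 l0 orbF => /eqP ab0'.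
rewrite mulf_eq0 l0 orbF => b0'; rewrite size_Mmonic ?monicXsubC // size_XsubC addn2 => le_b.
by rewrite (IHn _ _ le_b ab0') eqxx in b0'.
Qed.

Definition cubic_poly (A : comNzRingType) (t : A) : {poly A} :=
  (cubic_coef3 t)%:P * 'X^3 + (cubic_coef2 t)%:P * 'X^2 + (cubic_coef1 t)%:P * 'X + (cubic_coef0 t)%:P.

Lemma coef_cubic_poly (A : comNzRingType) (t : A) n :
  (cubic_poly t)`_n = nth 0 [:: cubic_coef0 t; cubic_coef1 t; cubic_coef2 t; cubic_coef3 t] n.
Proof.
rewrite /cubic_poly !coefD !coefCM !coefXn coefX coefC.
by case: n => [|[|[|[|n]]]] /=; rewrite ?(mulr0, mulr1, addr0, add0r) // nth_nil.
Qed.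

Lemma map_cubic_poly (A B : comNzRingType) (f : {rmorphism A -> B}) t :
  map_poly f (cubic_poly t) = cubic_poly (f t).
Proof.
apply/polyP => n; rewrite coef_map !coef_cubic_poly.
case: n => [|[|[|[|n]]]] /=; rewrite ?nth_nil ?rmorph0 //.
- exact: rmorph_cubic_coef0.
- exact: rmorph_cubic_coef1.
- exact: rmorph_cubic_coef2.
- exact: rmorph_cubic_coef3.
Qed.

Lemma horner_cubic_poly (A : comNzRingType) (t x : A) :
  (cubic_poly t).[x] = cubic_form t x 1.
Proof.
rewrite /cubic_form /binary_cubic !expr1n !mulr1 /cubic_poly !hornerD.
by rewrite !hornerCM !hornerXn hornerX hornerC.
Qed.

Lemma size_cubic_poly : size (cubic_poly (tofrac 'X : {fraction {poly rat}})) = 4%N.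
Proof.
apply/eqP; rewrite eqn_leq; apply/andP; split.
  apply/leq_sizeP => j j4; rewrite coef_cubic_poly nth_default //.
rewrite ltnNge; apply/negP => /leq_sizeP/(_ 3%N (leqnn _)).
rewrite coef_cubic_poly /= -rmorph_cubic_coef3 => /eqP; rewrite tofrac_eq0.
(* The leading coefficient takes the nonzero value -12 at -1. *)
move=> /eqP/(congr1 (horner_eval (- 1))); rewrite rmorph_cubic_coef3 rmorph0.
rewrite /= /horner_eval hornerX /cubic_coef3 => /eqP.
by rewrite (_ : _ + _ = - 12%:R) ?oppr_eq0 //; ring.
Qed.

(** A cubic over a field is irreducible once it has no root; clearing denominators in a root
    contradicts [cubic_form_poly], as the denominator is nonzero. *)
Lemma cubic_poly_irreducible :
  irreducible_poly (cubic_poly (tofrac 'X : {fraction {poly rat}})).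
Proof.
apply: cubic_irreducible => [|x]; first by rewrite size_cubic_poly.
apply/negP; rewrite /root horner_cubic_poly => /eqP x0.
have d0 : tofrac \d_(repr x) != 0 by rewrite tofrac_eq0 denom_ratioP.
have /eqP := denom_ratioP (repr x); apply.
apply: (@cubic_form_poly \n_(repr x)); apply/eqP; rewrite -tofrac_eq0.
rewrite rmorph_cubic_form /=.
have {1}-> : tofrac \n_(repr x) = x * tofrac \d_(repr x).
  by rewrite {2}[x]frac_numden divfK.
by rewrite -{2}[tofrac \d_(repr x)]mul1r /cubic_form binary_cubicM -/(cubic_form _ _ _) x0 mul0r.
Qed.

Lemma ratfun_laurent_tofrac p : ratfun_laurent (tofrac p) = tofrac (fps_of_poly p).
Proof.
rewrite -[tofrac p]divr1 -tofrac1 /ratfun_laurent frac_mapE ?oner_eq0 //.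
by rewrite rmorph1 tofrac1 divr1.
Qed.

Lemma gf_avoidingE : gf_avoiding = 1 + fps_var rat * (fps_geom rat + climb_gf rat 0).
Proof. by apply: fpsP => n; rewrite -completions_nil -count_avoidingE. Qed.

Lemma root_gf_avoiding :
  root (map_poly ratfun_laurent (cubic_poly (tofrac 'X))) (tofrac gf_avoiding).
Proof.
rewrite map_cubic_poly /root horner_cubic_poly /= ratfun_laurent_tofrac.
rewrite -(rmorph1 (@tofrac (fps rat))) -rmorph_cubic_form tofrac_eq0.
rewrite /cubic_form /binary_cubic !expr1n !mulr1.
by apply/eqP; apply: avoiding_cubic gf_avoidingE.
Qed.
Theorem theorem4p6 :
  let F : {fraction (fps rat)} := tofrac gf_avoiding in
  let t : {fraction {poly rat}} := tofrac 'X in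
  algebraicOver ratfun_laurent F /\
  minimal_polynomial ratfun_laurent F
    ((t ^+ 5 - 3 * t ^+ 4 + 4 * t ^+ 3 - 3 * t ^+ 2 + t)%:P * 'X^3
     + (4 * t ^+ 4 - 8 * t ^+ 3 + 6 * t ^+ 2 - 2 * t)%:P * 'X^2
     + (- t ^+ 4 + 8 * t ^+ 3 - 11 * t ^+ 2 + 6 * t - 1)%:P * 'X
     + (- 2 * t ^+ 3 + 5 * t ^+ 2 - 4 * t + 1)%:P).
Proof.
move=> F t; have rootP : root (map_poly ratfun_laurent (cubic_poly t)) F.
  exact: root_gf_avoiding.
have P0 : cubic_poly t != 0 by rewrite -size_poly_eq0 size_cubic_poly.
split; first by exists (cubic_poly t).
split=> // q q0 rootq; rewrite leqNgt; apply/negP => lt_q.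
(* Irreducibility makes any nonzero [q] of smaller degree coprime to the cubic; coprimality persists
   over the larger field and excludes a common root. *)
have co : coprimep (cubic_poly t) q.
  rewrite irreducible_poly_coprime; last exact: cubic_poly_irreducible.
  by apply/negP => /(dvdp_leq q0); rewrite leqNgt lt_q.
move: co; rewrite -(coprimep_map ratfun_laurent) => /coprimep_root/(_ rootP).
by rewrite -/(root _ _) rootq.
Qed.
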